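(* Let $q>0$, let $m\ge 1$, and let $A:\mathbb{R}\to\mathcal{M}(m,\mathbb{C})$ be continuous and $q$-periodic, i.e. $A(t+q)=A(t)$ for all $t\in\mathbb{R}$. Let $\Phi:\mathbb{R}\to\mathcal{M}(m,\mathbb{C})$ be the unique solution of $\dot{\Phi}(t)=A(t)\Phi(t)$, $\Phi(0)=I$, and assume that $\Phi(t)\Phi^{-1}(s)=\Phi^{-1}(s)\Phi(t)$ for all $t,s\in\mathbb{R}$. Put $U(t,s)=\Phi(t)\Phi^{-1}(s)$, $V(t,s)=U^{-1}(t,s)=\Phi(s)\Phi^{-1}(t)$, and $L=U(q,0)$, and for $\mu\in\mathbb{R}$ put $$\Phi_\mu(q)=\int_0^q U(q,s)e^{i\mu s}\,ds,\qquad \Psi_\mu(q)=\int_0^q V(q,s)e^{i\mu s}\,ds .$$ Suppose that for each $\mu\in\mathbb{R}$ the matrices $\Phi_\mu(q)$ and $\Psi_\mu(q)$ are invertible, and that there exists a projection $P:\mathbb{C}^m\to\mathbb{C}^m$ commuting with $L$ and with $\Phi_\mu(q)$ and $\Psi_\mu(q)$ for every $\mu\in\mathbb{R}$, such that for each $\mu\in\mathbb{R}$ and each non-zero vector $b\in\mathbb{C}^m$ the solutions of the Cauchy problems $(A(t),\mu,Pb,0)$ and $(-A(t),\mu,(I-P)b,0)$, namely $$t\mapsto\int_0^t U(t,s)e^{i\mu s}Pb\,ds\qquad\text{and}\qquad t\mapsto\int_0^t V(t,s)e^{i\mu s}(I-P)b\,ds,$$ are bounded on $[0,\infty)$. Then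 the Poincaré map $L$ is dichotomic.
   Context: $\mathcal{M}(m,\mathbb{C})$ is the set of $m\times m$ complex matrices and $I$ is the identity matrix. The matrix $\Phi(t)$ is invertible for every $t$. A matrix $L$ is called dichotomic if its spectrum $\sigma(L)$ does not intersect the unit circle $\{z\in\mathbb{C}:|z|=1\}$. A projection is a linear map $P:\mathbb{C}^m\to\mathbb{C}^m$ with $P^2=P$. The matrix $L=U(q,0)$ is called the Poincaré map. The Cauchy problem $(A(t),\mu,Pb,0)$ is $\dot X(t)=A(t)X(t)+e^{i\mu t}Pb$, $t\ge0$, $X(0)=0$; its solution is $\int_0^t U(t,s)e^{i\mu s}Pb\,ds$. The Cauchy problem $(-A(t),\mu,(I-P)b,0)$ is written $\dot X(t)=-X(t)A(t)+e^{i\mu t}(I-P)b$, $t\ge 0$, $X(0)=0$; by its solution is meant the function $\int_0^t V(t,s)e^{i\mu s}(I-P)b\,ds$. *)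

(* Defs.v *)
From mathcomp Require Import all_boot all_order all_algebra.
From mathcomp Require Import all_classical all_reals all_analysis.
From mathcomp Require Import complex.

Set Implicit Arguments.
Unset Strict Implicit.
Unset Printing Implicit Defensive.

Import Order.TTheory GRing.Theory Num.Theory.
Import numFieldNormedType.Exports.

Local Open Scope classical_set_scope.
Local Open Scope ring_scope.
Local Open Scope complex_scope.

(** Calculus for matrix-valued functions of a real variable with entries in
    [R[i]].  The type [R[i]] carries no normed module structure over [R] in the
    library, so continuity, derivative and integral are taken on real and
    imaginary parts, using the library notions for ['M[R]_(m, n)] and [R]. *)
Section ComplexMatrixCalculus.
Context {R : realType} {m n : nat}.
Implicit Types F : R -> 'M[R[i]]_(m, n).

Definition Re_mx (M : 'M[R[i]]_(m, n)) : 'M[R]_(m, n) := map_mx (@complex.Re R) M.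
Definition Im_mx (M : 'M[R[i]]_(m, n)) : 'M[R]_(m, n) := map_mx (@complex.Im R) M.

Definition cmx_continuous F : Prop :=
  continuous (fun t => Re_mx (F t)) /\ continuous (fun t => Im_mx (F t)).

Definition cmx_is_derive (t : R) F (D : 'M[R[i]]_(m, n)) : Prop :=
  is_derive t 1 (fun s => Re_mx (F s)) (Re_mx D) /\
  is_derive t 1 (fun s => Im_mx (F s)) (Im_mx D).

(** Intended for [a <= b]. *)
Definition cmx_integral (a b : R) F : 'M[R[i]]_(m, n) :=
  \matrix_(i, j)
    ((\int[lebesgue_measure]_(s in `[a, b]) complex.Re (F s i j)) +i*
     (\int[lebesgue_measure]_(s in `[a, b]) complex.Im (F s i j))).

(** [`| _ |] is the library's sup norm on matrices, with values in [R[i]]. *)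
Definition cmx_bounded_nonneg F : Prop :=
  exists M : R, forall t : R, 0 <= t -> `|F t| <= M%:C.

End ComplexMatrixCalculus.

Definition expi {R : realType} (x : R) : R[i] := cos x +i* sin x.

Definition spectrum {R : realType} {m : nat} (L : 'M[R[i]]_m) : set R[i] :=
  [set z | eigenvalue L z].

Definition unit_circle {R : realType} : set R[i] := [set z | `|z| = 1].

Definition dichotomic {R : realType} {m : nat} (L : 'M[R[i]]_m) : Prop :=
  spectrum L `&` unit_circle = set0.

Definition is_projection {R : realType} {m : nat} (P : 'M[R[i]]_m) : Prop :=
  P *m P = P.

Definition fundamental_solution {R : realType} {m : nat}
    (A Phi : R -> 'M[R[i]]_m) : Prop :=
  (forall t, cmx_is_derive t Phi (A t *m Phi t)) /\ Phi 0 = 1%:M.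

(** [Phi t] is invertible for every [t] when [Phi] is a fundamental solution,
    so the junk value of [invmx] on singular matrices plays no role below. *)
Section Evolution.
Context {R : realType} {m : nat} (Phi : R -> 'M[R[i]]_m).

Definition evolU (t s : R) : 'M[R[i]]_m := Phi t *m invmx (Phi s).
Definition evolV (t s : R) : 'M[R[i]]_m := invmx (evolU t s).

Lemma evolVE (t s : R) : Phi t \in unitmx -> Phi s \in unitmx ->
  evolV t s = Phi s *m invmx (Phi t).
Proof.
move=> ut us; rewrite /evolV /evolU.
have uU : Phi t *m invmx (Phi s) \in unitmx by rewrite unitmx_mul ut unitmx_inv.
rewrite -[RHS]mulmx1 -(mulmxV uU) !mulmxA mulmxKV //.
by rewrite mulmxV // mul1mx.
Qed.

Definition poincare (q : R) : 'M[R[i]]_m := evolU q 0.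

Definition Phi_mu (q mu : R) : 'M[R[i]]_m :=
  cmx_integral 0 q (fun s => expi (mu * s) *: evolU q s).

Definition Psi_mu (q mu : R) : 'M[R[i]]_m :=
  cmx_integral 0 q (fun s => expi (mu * s) *: evolV q s).

(** Solution of [X' = A X + e^{i mu t} c], [X 0 = 0]. *)
Definition cauchy_solU (mu : R) (c : 'cV[R[i]]_m) (t : R) : 'cV[R[i]]_m :=
  cmx_integral 0 t (fun s => expi (mu * s) *: (evolU t s *m c)).

(** "Solution" of [X' = - X A + e^{i mu t} c], [X 0 = 0]: the product [X A] is
    only formal for a column vector [X], and this integral is the meaning. *)
Definition cauchy_solV (mu : R) (c : 'cV[R[i]]_m) (t : R) : 'cV[R[i]]_m :=
  cmx_integral 0 t (fun s => expi (mu * s) *: (evolV t s *m c)).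

End Evolution.

(* Main.v *)
Require Import Defs.
From mathcomp Require Import all_boot all_order all_algebra.
From mathcomp Require Import all_classical all_reals all_analysis.
From mathcomp Require Import complex.
From mathcomp Require Import ring lra.

Import Order.TTheory GRing.Theory Num.Theory.
Import numFieldNormedType.Exports.

Local Open Scope ring_scope.
Local Open Scope complex_scope.

(** Let [v] be a row eigenvector of [L] for an eigenvalue [z = e^{i mu q}] of
    modulus 1.  Since [Phi (t + q) = Phi t *m L], the function
    [g s = e^{i mu s} v Phi(s)^-1 P c] is [q]-periodic and [v] applied to the
    solution of [(A, mu, P c, 0)] at time [n q] equals [z^n n int_0^q g].
    Boundedness forces the integral to vanish, i.e. [v Phi_mu(q) P c = 0] for
    all [c], hence [v P = 0] because [P] commutes with the invertible
    [Phi_mu(q)].  The same argument with [V] and the frequency [- mu] gives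
    [v (1 - P) = 0], so [v = 0]. *)

(** * Real integrals of continuous and periodic functions *)

Section RealIntegral.
Context {R : realType}.
Local Notation mu := (@lebesgue_measure R).
Local Open Scope classical_set_scope.
Implicit Types (f g : R -> R) (a b c q : R).

Lemma continuous_itv_integrable f a b :
  continuous f -> mu.-integrable `[a, b] (EFin \o f).
Proof.
move=> cf; apply: continuous_compact_integrable; first exact: segment_compact.
exact: continuous_subspaceT.
Qed.

Lemma Rintegral_itv_split f a b c : a <= b -> b <= c -> continuous f ->
  \int[mu]_(x in `[a, c]) f x =
  \int[mu]_(x in `[a, b]) f x + \int[mu]_(x in `[b, c]) f x.
Proof.
move=> ab bc cf.
have := @Rintegral_itvB R f (BLeft a) (BRight c) b
  (continuous_itv_integrable _ a c cf).
rewrite !bnd_simp ab bc => /(_ isT isT).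
(* The difference of integrals lives on the half-open interval from [b] to [c]; adding the endpoint
   [b] changes nothing, a point being a null set. *)
rewrite Rintegral_itv_obnd_cbnd.
  by move=> <-; rewrite addrC subrK.
apply: integrableS (continuous_itv_integrable _ b c cf) => //.
exact: subset_itv_oc_cc.
Qed.

(** Increasing substitution along [shift c]: its derivative is the constant 1, which settles the
    side conditions on the derivative and its limits at the ends. *)
Lemma Rintegral_itv_shift f a b c : a <= b -> continuous f ->
  \int[mu]_(x in `[a + c, b + c]) f x = \int[mu]_(x in `[a, b]) f (x + c).
Proof.
move=> ab cf.
have D1 : (shift c : R -> R)^`() = cst 1.
  apply/funext => x; rewrite derive1E.
  exact: (@derive_val _ _ _ _ _ _ _ (is_derive_shift x (1 : R) c)).
rewrite /Rintegral (@integration_by_substitution_increasing _ (shift c)) //.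
- by congr fine; apply: eq_integral => x _; rewrite D1 /= mulr1.
- by move=> x y _ _ xy; rewrite /= ltrD2r.
- by rewrite D1 => x _; exact: cvg_cst.
- by rewrite D1; exact: is_cvg_cst.
- by rewrite D1; exact: is_cvg_cst.
- split => //.
  + by apply: cvg_at_right_filter; apply: cvgD => //; exact: cvg_cst.
  + by apply: cvg_at_left_filter; apply: cvgD => //; exact: cvg_cst.
- exact: continuous_subspaceT.
Qed.

(** Induction on [n]: the first period is split off, and the remaining interval is translated back
    by [q], where periodicity restores the integrand. *)
Lemma Rintegral_periodic f q (n : nat) : 0 <= q -> continuous f ->
  (forall t, f (t + q) = f t) ->
  \int[mu]_(x in `[0, n%:R * q]) f x = n%:R * \int[mu]_(x in `[0, q]) f x.
Proof.
move=> q0 cf fq; elim: n => [|n IH].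
  by rewrite !mul0r set_itv1 Rintegral_set1.
have nq0 : 0 <= n%:R * q by rewrite mulr_ge0.
rewrite (@Rintegral_itv_split _ 0 q) //; last by rewrite mulr_natl mulrS lerDl -mulr_natl.
have -> : `[q, n.+1%:R * q] = `[0 + q, n%:R * q + q]%classic.
  by rewrite add0r -natr1 mulrDl mul1r.
rewrite Rintegral_itv_shift // -natr1 mulrDl mul1r addrC -IH; congr (_ + _).
by apply: eq_Rintegral => x _.
Qed.

End RealIntegral.

(** * Uniqueness for real linear systems *)

Section LinearODE.
Context {R : realType} {I : finType}.
Implicit Types (y : I -> R -> R) (a : I -> I -> R -> R).

Lemma is_derive_bigsum (h : I -> R -> R) (t : R) (dh : I -> R) :
  (forall i, is_derive t 1 (h i) (dh i)) ->
  is_derive t 1 (fun s => \sum_i h i s) (\sum_i dh i).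
Proof.
move=> H; rewrite (_ : (fun s => _) = \sum_i h i); last first.
  by apply/funext => s; rewrite fct_sumE.
by elim/big_ind2 : _ => // [|] *; [exact: is_derive_cst|exact: is_deriveD].
Qed.

(* Gronwall's argument for the energy [E = \sum_i y_i ^ 2]: on [t0, t1] one has
   [E' <= 2 (max k) E], so [E e^{- 2 (max k) t}] is nonincreasing. *)
Lemma linear_ode_uniq_fwd a y (t0 : R) :
  (forall i j, continuous (a i j)) ->
  (forall i (t : R), is_derive t 1 (y i) (\sum_j a i j t * y j t)) ->
  (forall i, y i t0 = 0) -> forall i t, t0 <= t -> y i t = 0.
Proof.
move=> ca dy y0 i0 t1 t01.
pose k (t : R) : R := \sum_i \sum_j `|a i j t|.
have ck : continuous k.
  apply: continuous_big => [|i _]; first by apply: add_continuous.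
  apply: continuous_big => [|j _ t]; first by apply: add_continuous.
  by apply: cvg_norm; exact: ca.
have [c _ kc] := @EVT_max R k t0 t1 t01 (continuous_subspaceT ck).
pose E (t : R) : R := \sum_i y i t ^+ 2.
have dE (t : R) : is_derive t 1 E (\sum_i \sum_j 2 * (a i j t * y i t * y j t)).
  apply: is_derive_bigsum => i.
  apply: is_derive_eq (is_deriveX 2 (dy i t)) _.
  rewrite expr1 /GRing.scale /= mulr_sumr.
  by apply: eq_bigr => j _; ring.
have E0 t : 0 <= E t by apply: sumr_ge0 => i _; exact: sqr_ge0.
have yE i t : y i t ^+ 2 <= E t.
  by rewrite /E (bigD1 i) //= lerDl; apply: sumr_ge0 => j _; exact: sqr_ge0.
have dEle t : \sum_i \sum_j 2 * (a i j t * y i t * y j t) <= 2 * k t * E t.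
  rewrite [2 * k t]mulr_sumr mulr_suml; apply: ler_sum => i _.
  rewrite [2 * _]mulr_sumr mulr_suml; apply: ler_sum => j _.
  (* From [(y i t - y j t) ^+ 2 >= 0] and [(y i t + y j t) ^+ 2 >= 0], the left side is at most
     [y i t ^+ 2 + y j t ^+ 2], and each square is at most [E t]. *)
  have h1 : `|2 * (y i t * y j t)| <= 2 * E t.
    have := yE i t; have := yE j t.
    have := sqr_ge0 (y i t - y j t); have := sqr_ge0 (y i t + y j t).
    by rewrite ler_norml; nra.
  have h2 := ler_norm (a i j t * (2 * (y i t * y j t))).
  rewrite normrM in h2.
  have h3 := ler_wpM2l (normr_ge0 (a i j t)) h1.
  by lra.
pose F (t : R) : R := E t * expR (- (2 * k c) * t).
have dF (t : R) : is_derive t 1 F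
    ((\sum_i \sum_j 2 * (a i j t * y i t * y j t) - 2 * k c * E t)
      * expR (- (2 * k c) * t)).
  have dl : is_derive t (1 : R) (fun s => - (2 * k c) * s) (- (2 * k c)).
    apply: is_derive_eq (is_deriveZ (- (2 * k c)) (is_derive_id t (1 : R))) _.
    by rewrite /GRing.scale /= mulr1.
  have de := is_derive1_comp (is_derive_expR (- (2 * k c) * t)) dl.
  apply: is_derive_eq (is_deriveM (dE t) de) _.
  by rewrite /GRing.scale /=; ring.
have cF : continuous F.
  move=> t; apply: differentiable_continuous.
  by apply/derivable1_diffP; case: (dF t).
have dF_le0 x : x \in `]t0, t1[ -> derive1 F x <= 0.
  rewrite in_itv /= => /andP[x0 x1].
  rewrite derive1E (@derive_val _ _ _ _ _ _ _ (dF x)) pmulr_lle0 ?expR_gt0 //.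
  rewrite subr_le0; apply: le_trans (dEle x) _.
  by rewrite ler_wpM2r // ler_pM2l // kc // in_itv /= !ltW.
have : F t1 <= F t0.
  apply: (ler0_derive1_le_cc _ dF_le0 (continuous_subspaceT cF)).
  - by move=> x _; case: (dF x).
  - by rewrite bound_itvE.
  - by rewrite bound_itvE.
  - exact: t01.
(* The initial condition gives [F t0 = 0], so [E t1 <= 0], which forces every square in the sum to
   vanish. *)
rewrite /F {2}/E [X in _ <= X * _]big1 ?mul0r; last by move=> i _; rewrite y0 expr0n.
rewrite pmulr_lle0 ?expR_gt0 // => Et.
apply/eqP; rewrite -sqrf_eq0 eq_le sqr_ge0 andbT.
exact: le_trans (yE _ _) Et.
Qed.

Lemma linear_ode_uniq a y (t0 : R) :
  (forall i j, continuous (a i j)) ->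
  (forall i (t : R), is_derive t 1 (y i) (\sum_j a i j t * y j t)) ->
  (forall i, y i t0 = 0) -> forall i t, y i t = 0.
Proof.
move=> ca dy y0 i t; have [t0t|tt0] := leP t0 t.
  exact: (@linear_ode_uniq_fwd a y t0).
rewrite -[t]opprK.
(* Times before [t0] are reached by time reversal: [s |-> y i (- s)] solves the system with
   coefficients [- a i j (- s)], starting from [- t0]. *)
apply: (@linear_ode_uniq_fwd (fun i j s => - a i j (- s))
  (fun i s => y i (- s)) (- t0)) => [j l s|j s|j|].
- apply: continuousN.
  apply: (@continuous_comp _ _ _ -%R (a j l)); first exact: opp_continuous.
  exact: ca.
- apply: is_derive_eq
    (is_derive1_comp (dy j (- s)) (is_deriveNid s (1 : R))) _.
  rewrite mulrN1 -sumrN.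
  by apply: eq_bigr => l _; rewrite mulNr.
- by rewrite opprK.
- by rewrite lerN2 ltW.
Qed.

End LinearODE.

(** * Calculus of complex-valued functions of a real variable *)

Section ComplexValuedFunctions.
Context {R : realType}.
Local Notation mu := (@lebesgue_measure R).
Local Open Scope classical_set_scope.
Implicit Types (f g : R -> R[i]) (z w : R[i]) (a b q t : R).

Lemma complex_ReD z w : complex.Re (z + w) = complex.Re z + complex.Re w.
Proof. by case: z w => [? ?] [? ?]. Qed.

Lemma complex_ImD z w : complex.Im (z + w) = complex.Im z + complex.Im w.
Proof. by case: z w => [? ?] [? ?]. Qed.

Lemma complex_ReM z w : complex.Re (z * w) =
  complex.Re z * complex.Re w - complex.Im z * complex.Im w.
Proof. by case: z w => [? ?] [? ?]. Qed.

Lemma complex_ImM z w : complex.Im (z * w) =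
  complex.Re z * complex.Im w + complex.Im z * complex.Re w.
Proof. by case: z w => [? ?] [? ?]. Qed.

Lemma complex_Re_sum (J : Type) (r : seq J) (h : J -> R[i]) :
  complex.Re (\sum_(i <- r) h i) = \sum_(i <- r) complex.Re (h i).
Proof. by elim/big_rec2 : _ => //= i x y _ <-; rewrite complex_ReD. Qed.

Lemma complex_Im_sum (J : Type) (r : seq J) (h : J -> R[i]) :
  complex.Im (\sum_(i <- r) h i) = \sum_(i <- r) complex.Im (h i).
Proof. by elim/big_rec2 : _ => //= i x y _ <-; rewrite complex_ImD. Qed.

Lemma expiD (x y : R) : expi (x + y) = expi x * expi y.
Proof. by apply/eqP; rewrite eq_complex /= cosD sinD addrC [_ * cos y + _]addrC !eqxx. Qed.

Lemma expi0 : expi (0 : R) = 1.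
Proof. by rewrite /expi cos0 sin0. Qed.

(** The angle is [acos] of the real part, up to sign. Since [sin (acos c)] is the nonnegative root
    of [1 - c ^+ 2], the sign of the angle follows that of the imaginary part. *)
Lemma norm_eq1_expi z : `|z| = 1 -> exists x : R, z = expi x.
Proof.
case: z => c d; rewrite normc_def => -[] /= cd.
have {}cd : c ^+ 2 + d ^+ 2 = 1.
  have h : 0 <= c ^+ 2 + d ^+ 2 by rewrite addr_ge0 ?sqr_ge0.
  by rewrite -(sqr_sqrtr h) cd expr1n.
have c1 : -1 <= c <= 1.
  by have d2 := sqr_ge0 d; apply/andP; split; nra.
have dE : Num.sqrt (1 - c ^+ 2) = `|d|.
  by rewrite -cd addrC addKr sqrtr_sqr.
have [d0|d0] := leP 0 d.
- exists (acos c); rewrite /expi acosK ?in_itv //= sin_acos // dE.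
  by rewrite ger0_norm.
- exists (- acos c); rewrite /expi cosN sinN acosK ?in_itv //= sin_acos // dE.
  by rewrite ltr0_norm // opprK.
Qed.

Definition ccontinuous f : Prop :=
  continuous (fun s => complex.Re (f s)) /\
  continuous (fun s => complex.Im (f s)).

Lemma ccontinuous_cst z : ccontinuous (fun=> z).
Proof. by split=> s; exact: cvg_cst. Qed.

Lemma ccontinuousD f g : ccontinuous f -> ccontinuous g ->
  ccontinuous (fun s => f s + g s).
Proof.
move=> [f1 f2] [g1 g2]; split.
- under eq_fun do rewrite complex_ReD.
  by move=> s; apply: cvgD; [exact: f1|exact: g1].
- under eq_fun do rewrite complex_ImD.
  by move=> s; apply: cvgD; [exact: f2|exact: g2].
Qed.

Lemma ccontinuousM f g : ccontinuous f -> ccontinuous g ->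
  ccontinuous (fun s => f s * g s).
Proof.
move=> [f1 f2] [g1 g2]; split.
- under eq_fun do rewrite complex_ReM.
  by move=> s; apply: cvgB; apply: cvgM;
    [exact: f1|exact: g1|exact: f2|exact: g2].
- under eq_fun do rewrite complex_ImM.
  by move=> s; apply: cvgD; apply: cvgM;
    [exact: f1|exact: g2|exact: f2|exact: g1].
Qed.

Lemma ccontinuous_sum (J : Type) (r : seq J) (h : J -> R -> R[i]) :
  (forall i, ccontinuous (h i)) -> ccontinuous (fun s => \sum_(i <- r) h i s).
Proof.
move=> ch; elim: r => [|i r IH].
  by under eq_fun do rewrite big_nil; exact: ccontinuous_cst.
by under eq_fun do rewrite big_cons; exact: ccontinuousD.
Qed.

Lemma ccontinuous_prod (J : Type) (r : seq J) (h : J -> R -> R[i]) :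
  (forall i, ccontinuous (h i)) -> ccontinuous (fun s => \prod_(i <- r) h i s).
Proof.
move=> ch; elim: r => [|i r IH].
  by under eq_fun do rewrite big_nil; exact: ccontinuous_cst.
by under eq_fun do rewrite big_cons; exact: ccontinuousM.
Qed.

Lemma ccontinuousV f : (forall s, f s != 0) -> ccontinuous f ->
  ccontinuous (fun s => (f s)^-1).
Proof.
move=> f0 [f1 f2].
(* [n] is the squared modulus of [f], so the inverse of [f] is its conjugate divided by [n]. *)
pose n s := complex.Re (f s) ^+ 2 + complex.Im (f s) ^+ 2.
have n0 s : n s != 0.
  rewrite /n paddr_eq0 ?sqr_ge0 // !sqrf_eq0 -(eq_complex (f s) 0).
  exact: f0.
have cn : continuous n.
  move=> s; apply: cvgD; rewrite /continuous_at /=.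
  - by apply: cvgM; exact: f1.
  - by apply: cvgM; exact: f2.
have cV : continuous (fun s => (n s)^-1).
  by move=> s; apply: cvgV; [exact: n0|exact: cn].
have VE s : (f s)^-1 =
    (complex.Re (f s) * (n s)^-1) +i* (- (complex.Im (f s) * (n s)^-1)).
  by rewrite /n; case: (f s).
split; under eq_fun do rewrite VE /=.
- by move=> s; apply: cvgM; [exact: f1|exact: cV].
- by move=> s; apply: cvgN; apply: cvgM; [exact: f2|exact: cV].
Qed.

Lemma ccontinuous_expi c : ccontinuous (fun s => expi (c * s)).
Proof.
have cl : continuous (fun s : R => c * s).
  by move=> s; apply: cvgMr; exact: cvg_id.
split=> s /=.
- by apply: (@continuous_comp _ _ _ (fun s => c * s) cos); [exact: cl|exact: continuous_cos].
- by apply: (@continuous_comp _ _ _ (fun s => c * s) sin); [exact: cl|exact: continuous_sin].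
Qed.

(** Has the shape of one entry of [cmx_integral], so that matrix integrals reduce to scalar ones by
    conversion. *)
Definition cintegral a b f : R[i] :=
  (\int[mu]_(s in `[a, b]) complex.Re (f s)) +i*
  (\int[mu]_(s in `[a, b]) complex.Im (f s)).

Lemma cintegral0 a b : cintegral a b (fun=> 0) = 0.
Proof. by rewrite /cintegral /= !Rintegral_cst //= !mul0r. Qed.

Lemma cintegralD a b f g : ccontinuous f -> ccontinuous g ->
  cintegral a b (fun s => f s + g s) = cintegral a b f + cintegral a b g.
Proof.
move=> [f1 f2] [g1 g2]; apply/eqP; rewrite eq_complex /=.
by rewrite -!RintegralD //; try exact: continuous_itv_integrable;
  apply/andP; split; apply/eqP; apply: eq_Rintegral => s _; rewrite ?complex_ReD ?complex_ImD.
Qed.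

Lemma cintegralZ a b z f : ccontinuous f ->
  cintegral a b (fun s => z * f s) = z * cintegral a b f.
Proof.
move=> [f1 f2]; have If1 := continuous_itv_integrable _ a b f1.
have If2 := continuous_itv_integrable _ a b f2.
apply/eqP; rewrite eq_complex complex_ReM complex_ImM /=; apply/andP; split; apply/eqP.
- rewrite -!RintegralZl // -RintegralB //; first last.
  + by apply: continuous_itv_integrable => s; apply: cvgMr; exact: f2.
  + by apply: continuous_itv_integrable => s; apply: cvgMr; exact: f1.
  by apply: eq_Rintegral => s _; rewrite complex_ReM.
- rewrite -!RintegralZl // -RintegralD //; first last.
  + by apply: continuous_itv_integrable => s; apply: cvgMr; exact: f1.
  + by apply: continuous_itv_integrable => s; apply: cvgMr; exact: f2.
  by apply: eq_Rintegral => s _; rewrite complex_ImM.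
Qed.

Lemma cintegral_sum (J : Type) (r : seq J) a b (h : J -> R -> R[i]) :
  (forall i, ccontinuous (h i)) ->
  cintegral a b (fun s => \sum_(i <- r) h i s) =
  \sum_(i <- r) cintegral a b (h i).
Proof.
move=> ch; elim: r => [|i r IH].
  by under eq_fun do rewrite big_nil; rewrite big_nil cintegral0.
under eq_fun do rewrite big_cons.
by rewrite big_cons -IH cintegralD //; exact: ccontinuous_sum.
Qed.

Lemma cintegral_periodic f q (n : nat) : 0 <= q -> ccontinuous f ->
  (forall t, f (t + q) = f t) ->
  cintegral 0 (n%:R * q) f = n%:R * cintegral 0 q f.
Proof.
move=> q0 [f1 f2] fq; rewrite /cintegral.
rewrite !Rintegral_periodic //; try by move=> t; rewrite fq.
rewrite -(rmorph_nat (real_complex R)) /=.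
by apply/eqP; rewrite eq_complex /= !mul0r subr0 addr0 !eqxx.
Qed.

Definition cis_derive t f z : Prop :=
  is_derive t 1 (fun s => complex.Re (f s)) (complex.Re z) /\
  is_derive t 1 (fun s => complex.Im (f s)) (complex.Im z).

Lemma cis_deriveD t f g z w : cis_derive t f z -> cis_derive t g w ->
  cis_derive t (fun s => f s + g s) (z + w).
Proof.
move=> [f1 f2] [g1 g2]; split.
- under eq_fun do rewrite complex_ReD.
  by rewrite complex_ReD; exact: is_deriveD.
- under eq_fun do rewrite complex_ImD.
  by rewrite complex_ImD; exact: is_deriveD.
Qed.

Lemma cis_deriveMr t f z w : cis_derive t f z ->
  cis_derive t (fun s => f s * w) (z * w).
Proof.
have sc (u : R -> R) (du k : R) :
    is_derive t 1 u du -> is_derive t 1 (fun s => u s * k) (du * k).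
  move=> hu; under eq_fun do rewrite mulrC.
  by rewrite mulrC; exact: is_deriveZ.
move=> [f1 f2]; split.
- under eq_fun do rewrite complex_ReM.
  by rewrite complex_ReM; apply: is_deriveB; exact: sc.
- under eq_fun do rewrite complex_ImM.
  by rewrite complex_ImM; apply: is_deriveD; exact: sc.
Qed.

Lemma cis_derive_sum t (J : Type) (r : seq J) (h : J -> R -> R[i]) (dh : J -> R[i]) :
  (forall i, cis_derive t (h i) (dh i)) ->
  cis_derive t (fun s => \sum_(i <- r) h i s) (\sum_(i <- r) dh i).
Proof.
move=> ch; elim: r => [|i r IH].
  under eq_fun do rewrite big_nil; rewrite big_nil.
  by split; exact: is_derive_cst.
by under eq_fun do rewrite big_cons; rewrite big_cons; exact: cis_deriveD.
Qed.

Lemma cis_derive_shift t c f z : cis_derive (t + c) f z ->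
  cis_derive t (fun s => f (s + c)) z.
Proof.
have sh (u : R -> R) (du : R) :
    is_derive (t + c) 1 u du -> is_derive t 1 (fun s => u (s + c)) du.
  move=> hu.
  by rewrite -[du]mulr1;
    exact: (@is_derive1_comp R u (shift c) t du 1 hu (is_derive_shift t 1 c)).
by move=> [f1 f2]; split; exact: sh.
Qed.

Lemma cis_derive_ccontinuous f (df : R -> R[i]) :
  (forall t, cis_derive t f (df t)) -> ccontinuous f.
Proof.
move=> h; split=> t; apply: differentiable_continuous; apply/derivable1_diffP.
- by case: (h t) => -[].
- by case: (h t) => _ [].
Qed.

End ComplexValuedFunctions.

(** * Matrix functions: continuity, integrals, and uniqueness for linear equations *)

Section ComplexMatrices.
Context {R : realType}.
Implicit Types (q t : R).

Definition mx_ccontinuous {m n} (F : R -> 'M[R[i]]_(m, n)) : Prop :=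
  forall i j, ccontinuous (fun s => F s i j).

Lemma cmx_continuousP {m n} (F : R -> 'M[R[i]]_(m, n)) :
  cmx_continuous F -> mx_ccontinuous F.
Proof.
move=> [F1 F2] i j; split=> t.
- rewrite (_ : (fun s => _) = (fun M : 'M[R]_(m, n) => M i j) \o (fun s => Re_mx (F s))).
    by apply: continuous_comp; [exact: F1|exact: coord_continuous].
  by apply/funext => s; rewrite /= mxE.
- rewrite (_ : (fun s => _) = (fun M : 'M[R]_(m, n) => M i j) \o (fun s => Im_mx (F s))).
    by apply: continuous_comp; [exact: F2|exact: coord_continuous].
  by apply/funext => s; rewrite /= mxE.
Qed.

Lemma mx_ccontinuous_cst {m n} (M : 'M[R[i]]_(m, n)) :
  mx_ccontinuous (fun=> M).
Proof. by move=> i j; exact: ccontinuous_cst. Qed.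

Lemma mx_ccontinuousM {m n p} (F : R -> 'M[R[i]]_(m, n)) (G : R -> 'M[R[i]]_(n, p)) :
  mx_ccontinuous F -> mx_ccontinuous G -> mx_ccontinuous (fun s => F s *m G s).
Proof.
move=> cF cG i j; under eq_fun do rewrite mxE.
by apply: ccontinuous_sum => k; exact: ccontinuousM.
Qed.

Lemma mx_ccontinuousZ {m n} (f : R -> R[i]) (F : R -> 'M[R[i]]_(m, n)) :
  ccontinuous f -> mx_ccontinuous F -> mx_ccontinuous (fun s => f s *: F s).
Proof.
by move=> cf cF i j; under eq_fun do rewrite mxE; exact: ccontinuousM.
Qed.

Lemma ccontinuous_det {n} (F : R -> 'M[R[i]]_n) :
  mx_ccontinuous F -> ccontinuous (fun s => \det (F s)).
Proof.
move=> cF; apply: ccontinuous_sum => s.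
by apply: ccontinuousM; [exact: ccontinuous_cst|exact: ccontinuous_prod].
Qed.

(** Cramer's rule: the inverse is the adjugate over the determinant, and the entries of the adjugate
    are signed minors, hence continuous by [ccontinuous_det]. *)
Lemma mx_ccontinuous_inv {n} (F : R -> 'M[R[i]]_n) :
  (forall s, F s \in unitmx) -> mx_ccontinuous F ->
  mx_ccontinuous (fun s => invmx (F s)).
Proof.
move=> uF cF i j.
under eq_fun => s do rewrite /invmx uF !mxE.
apply: ccontinuousM.
  apply: ccontinuousV; last exact: ccontinuous_det.
  by move=> s; rewrite -unitfE; exact: uF.
apply: ccontinuousM; first exact: ccontinuous_cst.
apply: ccontinuous_det => k l.
by under eq_fun do rewrite !mxE; exact: cF.
Qed.

Lemma mulmx_cmx_integral {m n p} a b (M : 'M[R[i]]_(p, m)) (F : R -> 'M[R[i]]_(m, n)) :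
  mx_ccontinuous F ->
  M *m cmx_integral a b F = cmx_integral a b (fun s => M *m F s).
Proof.
move=> cF; apply/matrixP => i j; rewrite !mxE.
rewrite -[RHS]/(cintegral a b (fun s => (M *m F s) i j)).
under [in RHS]eq_fun do rewrite mxE.
rewrite cintegral_sum; last first.
  by move=> k; apply: ccontinuousM => //; exact: ccontinuous_cst.
by apply: eq_bigr => k _; rewrite mxE cintegralZ.
Qed.

Lemma cmx_integral_mulmx {m n p} a b (F : R -> 'M[R[i]]_(m, n)) (M : 'M[R[i]]_(n, p)) :
  mx_ccontinuous F ->
  cmx_integral a b F *m M = cmx_integral a b (fun s => F s *m M).
Proof.
move=> cF; apply/matrixP => i j; rewrite !mxE.
rewrite -[RHS]/(cintegral a b (fun s => (F s *m M) i j)).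
under [in RHS]eq_fun do rewrite mxE.
rewrite cintegral_sum; last first.
  by move=> k; apply: ccontinuousM => //; exact: ccontinuous_cst.
apply: eq_bigr => k _; rewrite mxE mulrC -cintegralZ //.
by congr cintegral; apply/funext => s; rewrite mulrC.
Qed.

Lemma cmx_is_deriveP {m n} t (F : R -> 'M[R[i]]_(m, n)) (D : 'M[R[i]]_(m, n)) :
  cmx_is_derive t F D -> forall i j, cis_derive t (fun s => F s i j) (D i j).
Proof.
have entry (G : R -> 'M[R]_(m, n)) (E : 'M[R]_(m, n)) i j :
    is_derive t 1 G E -> is_derive t 1 (fun s => G s i j) (E i j).
  move=> [dG <-]; apply: DeriveDef; first by move/derivable_mxP : dG.
  by rewrite derive_mx // mxE.
move=> [F1 F2] i j; split.
- have := entry _ _ i j F1; rewrite mxE.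
  by under eq_fun do rewrite mxE.
- have := entry _ _ i j F2; rewrite mxE.
  by under eq_fun do rewrite mxE.
Qed.

(** Each column of [F] is treated as a real system of twice the size, to which [linear_ode_uniq]
    applies. *)
Lemma mx_linear_ode_uniq {m k} (A : R -> 'M[R[i]]_m) (F : R -> 'M[R[i]]_(m, k)) t0 :
  cmx_continuous A ->
  (forall t i j, cis_derive t (fun s => F s i j) ((A t *m F t) i j)) ->
  F t0 = 0 -> forall t, F t = 0.
Proof.
move=> /cmx_continuousP cA dF F0 t; apply/matrixP => i j; rewrite mxE.
(* [inl] indexes real parts and [inr] imaginary parts of column [j]; [a] is then the real block
   matrix with rows [(Re A, - Im A)] and [(Im A, Re A)]. *)
pose y (x : 'I_m + 'I_m) (s : R) : R := match x with
  | inl l => complex.Re (F s l j) | inr l => complex.Im (F s l j) end.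
pose a (x x' : 'I_m + 'I_m) (s : R) : R := match x, x' with
  | inl l, inl l' => complex.Re (A s l l')
  | inl l, inr l' => - complex.Im (A s l l')
  | inr l, inl l' => complex.Im (A s l l')
  | inr l, inr l' => complex.Re (A s l l') end.
have y0 : forall x s, y x s = 0.
  apply: (@linear_ode_uniq R _ a y t0).
  - move=> [l|l] [l'|l'] //=.
    + exact: (cA l l').1.
    + by move=> s; apply: cvgN; exact: (cA l l').2.
    + exact: (cA l l').2.
    + exact: (cA l l').1.
  - move=> [l|l] s; rewrite big_sumType /= -big_split /=.
    + refine (is_derive_eq (dF s l j).1 _).
      by rewrite mxE complex_Re_sum; apply: eq_bigr => l' _; rewrite complex_ReM mulNr.
    + refine (is_derive_eq (dF s l j).2 _).
      by rewrite mxE complex_Im_sum; apply: eq_bigr => l' _; rewrite complex_ImM addrC.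
  - by move=> [l|l]; rewrite /y F0 mxE.
apply/eqP; rewrite eq_complex.
by rewrite [complex.Re _](y0 (inl i) t) [complex.Im _](y0 (inr i) t) eqxx.
Qed.

End ComplexMatrices.

(** * Invertibility and the Floquet relation for the fundamental solution *)

Section FundamentalSolution.
Context {R : realType} {m : nat} {A Phi : R -> 'M[R[i]]_m}.
Hypothesis cA : cmx_continuous A.
Hypothesis hPhi : fundamental_solution A Phi.

Lemma fundamental_solution_entry t i j :
  cis_derive t (fun s => Phi s i j) ((A t *m Phi t) i j).
Proof. by have [dPhi _] := hPhi; exact: cmx_is_deriveP. Qed.

(** Supplies the solutions for two uniqueness arguments: [W] is a kernel basis in the proof of
    invertibility, and [Phi q] in the period relation. *)
Lemma fundamental_solution_mulmx_derive {k} (W : 'M[R[i]]_(m, k)) t i j :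
  cis_derive t (fun s => (Phi s *m W) i j) ((A t *m (Phi t *m W)) i j).
Proof.
rewrite mulmxA mxE; under eq_fun do rewrite mxE.
by apply: cis_derive_sum => l; apply: cis_deriveMr; exact: fundamental_solution_entry.
Qed.

Lemma fundamental_solution_continuous : mx_ccontinuous Phi.
Proof.
move=> i j; apply: cis_derive_ccontinuous => t.
exact: fundamental_solution_entry.
Qed.

(** If [Phi t *m W = 0], the solution [s |-> Phi s *m W] vanishes at [t], hence also at 0, where it
    equals [W]. The transposes appear because [kermx] is a left kernel. *)
Lemma fundamental_solution_unit t : Phi t \in unitmx.
Proof.
rewrite -unitmx_tr -row_free_unit -kermx_eq0; apply/eqP.
apply: trmx_inj; rewrite trmx0 -[LHS]mul1mx -[X in X *m _]hPhi.2.
apply: (mx_linear_ode_uniq A (fun s => Phi s *m (kermx (Phi t)^T)^T) t cA).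
- by move=> s i j; exact: fundamental_solution_mulmx_derive.
- by apply: trmx_inj; rewrite trmx_mul trmxK mulmx_ker trmx0.
Qed.

(** By periodicity of [A], both sides solve the same linear equation in [t]; they agree at 0, so
    their difference vanishes by uniqueness. *)
Lemma fundamental_solution_period q t : (forall s, A (s + q) = A s) ->
  Phi (t + q) = Phi t *m Phi q.
Proof.
move=> Aq; apply/eqP; rewrite -subr_eq0; apply/eqP.
apply: (mx_linear_ode_uniq A (fun s => Phi (s + q) - Phi s *m Phi q) 0 cA);
  last by rewrite add0r hPhi.2 mul1mx subrr.
move=> s i j.
rewrite mulmxBr -!mulmxN mxE.
under eq_fun do rewrite mxE -mulmxN.
apply: cis_deriveD.
  apply: (cis_derive_shift s q (fun s => Phi s i j)).
  by rewrite -(Aq s); exact: fundamental_solution_entry.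
exact: fundamental_solution_mulmx_derive.
Qed.

End FundamentalSolution.

(** * Bounded solutions under resonant forcing *)

Section Resonance.
Context {R : realType} {m : nat}.
Implicit Types (v : 'rV[R[i]]_m) (c : 'cV[R[i]]_m).

Lemma mulmx_bounded v (X : R -> 'cV[R[i]]_m) :
  cmx_bounded_nonneg X ->
  exists C : R[i], forall t, 0 <= t -> `|(v *m X t) 0 0| <= C.
Proof.
move=> [M hM]; exists (\sum_i `|v 0 i| * M%:C) => t t0.
rewrite mxE; apply: le_trans (ler_norm_sum _ _ _) _.
apply: ler_sum => i _; rewrite normrM ler_wpM2l //.
apply: le_trans (hM t t0).
rewrite [leRHS]/Num.Def.normr /= mx_normE.
(* The sup norm is a maximum over index pairs, and the entry at [(i, 0)] is one of its terms. *)
exact: (le_bigmax _ (fun x => `|X t x.1 x.2|%:nng) (i, 0)).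
Qed.

(** The Archimedean property of [R], applied to real parts: an inequality in [R[i]] implies the one
    between real parts, and [|x|] is real. *)
Lemma natmul_norm_bounded_eq0 (x C : R[i]) :
  (forall n : nat, n%:R * `|x| <= C) -> x = 0.
Proof.
move=> hC; apply/eqP; rewrite -normr_eq0.
have xE : `|x| = (complex.Re `|x|)%:C by rewrite normc_def.
have x0 : 0 <= complex.Re `|x| by rewrite -lecR -xE; exact: normr_ge0.
suff -> : `|x| = 0 by [].
rewrite xE; suff -> : complex.Re `|x| = 0 by [].
apply/eqP; rewrite eq_le x0 andbT leNgt.
apply/negP => xgt0.
(* One more than the truncated quotient is an [n] for which [n * |x|] exceeds the real part of
   [C]. *)
have := truncnS_gt (complex.Re C / complex.Re `|x|).
rewrite ltr_pdivrMr // ltNge => /negP; apply.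
set n := (_.+1)%N.
have := hC n; rewrite lecE => /andP[_]; apply: le_trans.
by rewrite xE -(rmorph_nat (real_complex R)) -rmorphM.
Qed.

(* The forcing is in resonance with the homogeneous dynamics seen through [v]:
   after [n] periods the solution has accumulated [n] times the same integral. *)
Lemma resonance (q nu : R) (w : R[i]) (K : R -> R -> 'M[R[i]]_m) v c (g : R -> R[i]) :
  0 < q -> `|w| = 1 ->
  (forall t, mx_ccontinuous (K t)) ->
  ccontinuous g -> (forall s, g (s + q) = g s) ->
  (forall (n : nat) s,
     expi (nu * s) * (v *m (K (n%:R * q) s *m c)) 0 0 = w ^+ n * g s) ->
  cmx_bounded_nonneg
    (fun t => cmx_integral 0 t (fun s => expi (nu * s) *: (K t s *m c))) ->
  (v *m cmx_integral 0 q (fun s => expi (nu * s) *: K q s) *m c) 0 0 = 0.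
Proof.
move=> q0 w1 cK cg gq Kg /(mulmx_bounded v) [C hC].
have cE := @ccontinuous_expi R nu.
have cKc t : mx_ccontinuous (fun s => expi (nu * s) *: (K t s *m c)).
  by apply: mx_ccontinuousZ => //; apply: mx_ccontinuousM => //;
    exact: mx_ccontinuous_cst.
have solE (n : nat) : (v *m cmx_integral 0 (n%:R * q)
    (fun s => expi (nu * s) *: (K (n%:R * q) s *m c))) 0 0 =
    w ^+ n * (n%:R * cintegral 0 q g).
  rewrite mulmx_cmx_integral // mxE -cintegral_periodic ?ltW // -cintegralZ //.
  by congr cintegral; apply/funext => s; rewrite -scalemxAr mxE Kg.
(* As [w] has modulus 1, the factor [w ^+ n] disappears from the norm, leaving [n] times a fixed
   modulus below the bound [C]. *)
have g0 : cintegral 0 q g = 0.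
  apply: (@natmul_norm_bounded_eq0 _ C) => n.
  have nq0 : 0 <= n%:R * q by rewrite mulr_ge0 // ltW.
  have hCn := hC _ nq0.
  by rewrite solE !normrM normrX w1 expr1n mul1r normr_nat in hCn.
rewrite -mulmxA cmx_integral_mulmx; last exact: mx_ccontinuousZ.
(* For [n = 1] the solution is taken at time [q], which turns the integral of the goal into [w]
   times the vanishing integral of [g]. *)
have := solE 1%N; rewrite mul1r g0 !mulr0 => <-.
congr ((v *m cmx_integral 0 q _) 0 0).
by apply/funext => s; rewrite -scalemxAl.
Qed.

End Resonance.

(** Commutation gives [v P = (v M P) M^-1], and [v M P] is tested on the basis columns. These are
    non-zero, which matches the condition on [b] in the boundedness hypothesis of the theorem. *)
Lemma mulmx_commuting_unit_eq0 {F : fieldType} {m} (v : 'rV[F]_m) (M P : 'M[F]_m) :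
  M \in unitmx -> P *m M = M *m P ->
  (forall c : 'cV[F]_m, c <> 0 -> (v *m M *m (P *m c)) 0 0 = 0) -> v *m P = 0.
Proof.
move=> uM PM h; rewrite -[v *m P](mulmxK uM) -(mulmxA v) PM mulmxA.
suff -> : v *m M *m P = 0 by rewrite mul0mx.
apply/rowP => j; rewrite [RHS]mxE.
have /h : delta_mx j (0 : 'I_1) <> 0 :> 'cV[F]_m.
  by move=> /matrixP/(_ j 0)/eqP; rewrite !mxE !eqxx oner_eq0.
by rewrite (mulmxA _ P) -colE mxE.
Qed.

(** * Dichotomy of the Poincaré map *)

Theorem theorem3p3 (R : realType) (q : R) (hq : 0 < q) (m : nat) (hm : (1 <= m)%N)
    (A : R -> 'M[R[i]]_m)
    (hAcont : cmx_continuous A)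
    (hAper : forall t : R, A (t + q) = A t)
    (Phi : R -> 'M[R[i]]_m)
    (hPhi : fundamental_solution A Phi)
    (hcomm : forall t s : R,
      Phi t *m invmx (Phi s) = invmx (Phi s) *m Phi t)
    (hinv : forall mu : R,
      Phi_mu Phi q mu \in unitmx /\ Psi_mu Phi q mu \in unitmx)
    (hP : exists P : 'M[R[i]]_m,
      [/\ is_projection P,
          P *m poincare Phi q = poincare Phi q *m P,
          (forall mu : R,
            P *m Phi_mu Phi q mu = Phi_mu Phi q mu *m P /\
            P *m Psi_mu Phi q mu = Psi_mu Phi q mu *m P) &
          forall (mu : R) (b : 'cV[R[i]]_m), b <> 0 ->
            cmx_bounded_nonneg (cauchy_solU Phi mu (P *m b)) /\
            cmx_bounded_nonneg (cauchy_solV Phi mu ((1%:M - P) *m b))]) :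
  dichotomic (poincare Phi q).
Proof.
have [P [_ _ PM hb]] := hP.
have uPhi := fundamental_solution_unit hAcont hPhi.
have cPhi := fundamental_solution_continuous hPhi.
have perPhi s := fundamental_solution_period hAcont hPhi q s hAper.
have L_Phi : poincare Phi q = Phi q.
  by rewrite /poincare /evolU hPhi.2 invmx1 mulmx1.
apply/seteqP; split => // z [/eigenvalueP[v vL v0] z1].
rewrite L_Phi in vL; rewrite /unit_circle /= in z1.
have z0 : z != 0 by rewrite -normr_eq0 z1 oner_eq0.
have [x zx] := norm_eq1_expi z z1.
(* This frequency makes the forcing gain exactly the factor [z] over one period. *)
pose mu := x / q.
have muq : expi (mu * q) = z by rewrite zx /mu divfK // gt_eqF.
have Nmuq : expi (- mu * q) = z^-1.
  by apply: (mulfI z0); rewrite -{1}muq -expiD mulNr addrN expi0 mulfV.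
have vLV : v *m invmx (Phi q) = z^-1 *: v.
  by apply: (canRL (scalerK z0)); rewrite scalemxAl -vL mulmxK.
have vPhin (n : nat) : v *m Phi (n%:R * q) = z ^+ n *: v.
  elim: n => [|n IH]; first by rewrite mul0r hPhi.2 mulmx1 scale1r.
  by rewrite -natr1 mulrDl mul1r perPhi mulmxA IH -scalemxAl vL scalerA -exprSr.
have vPhiVn (n : nat) : v *m invmx (Phi (n%:R * q)) = z^-1 ^+ n *: v.
  rewrite exprVn; apply: (canRL (scalerK (expf_neq0 n z0))).
  by rewrite scalemxAl -vPhin mulmxK.
(* [hcomm] commutes [Phi s] with the inverse of [Phi q]; conjugation by [Phi q] turns this into
   commutation with [Phi q] itself. *)
have PhiC s : Phi s *m Phi q = Phi q *m Phi s.
  by rewrite -[RHS](mulmxKV (uPhi q)) -(mulmxA (Phi q)) hcomm !mulmxA mulmxV // mul1mx.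
have VE t s : evolV Phi t s = Phi s *m invmx (Phi t) by exact: evolVE.
have invPhi s : invmx (Phi (s + q)) = invmx (Phi q) *m invmx (Phi s).
  apply: (can_inj (mulKmx (uPhi (s + q)))).
  by rewrite mulmxV // perPhi -mulmxA mulKVmx // mulmxV.
have cPhiV := mx_ccontinuous_inv _ uPhi cPhi.
have cform (F : R -> 'M[R[i]]_m) (c : 'cV[R[i]]_m) nu : mx_ccontinuous F ->
    ccontinuous (fun s => expi (nu * s) * (v *m F s *m c) 0 0).
  move=> cF; apply: ccontinuousM; first exact: ccontinuous_expi.
  apply: mx_ccontinuousM; last exact: mx_ccontinuous_cst.
  by apply: mx_ccontinuousM => //; exact: mx_ccontinuous_cst.
have vP : v *m P = 0.
  apply: (mulmx_commuting_unit_eq0 _ _ _ (hinv mu).1 (PM mu).1) => c c0.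
  apply: (resonance q mu z (evolU Phi) v (P *m c)
    (fun s => expi (mu * s) * (v *m invmx (Phi s) *m (P *m c)) 0 0)) => //.
  - by move=> t; apply: mx_ccontinuousM; [exact: mx_ccontinuous_cst|].
  - exact: cform.
  (* Over one period the exponential gains [z] while [v] applied to the inverse of [Phi] gains
     [z^-1]; the two cancel. *)
  - move=> s; rewrite invPhi (mulmxA v) vLV mulrDr expiD muq -!scalemxAl mxE.
    by rewrite mulrA mulfK.
  - move=> n s; rewrite /evolU !mulmxA vPhin -!scalemxAl mxE.
    by rewrite mulrCA.
  - exact: (hb mu c c0).1.
have vQ : v *m (1%:M - P) = 0.
  apply: (mulmx_commuting_unit_eq0 _ _ _ (hinv (- mu)).2).
    by rewrite mulmxBl mulmxBr mul1mx mulmx1 (PM (- mu)).2.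
  move=> c c0.
  apply: (resonance q (- mu) z^-1 (evolV Phi) v ((1%:M - P) *m c)
    (fun s => expi (- mu * s) * (v *m Phi s *m ((1%:M - P) *m c)) 0 0)) => //.
  - by rewrite normfV z1 invr1.
  - move=> t; have -> : evolV Phi t = fun s => Phi s *m invmx (Phi t).
      by apply/funext => s; exact: VE.
    by apply: mx_ccontinuousM => //; exact: mx_ccontinuous_cst.
  - exact: cform.
  (* Here [Phi q] must stand next to [v] to produce [z], hence [PhiC]; the frequency [- mu]
     contributes the cancelling [z^-1]. *)
  - move=> s; rewrite perPhi PhiC (mulmxA v) vL mulrDr expiD Nmuq -!scalemxAl mxE.
    by rewrite mulrA divfK.
  (* [hcomm] moves the inverse of [Phi (n%:R * q)] to the left of [Phi s], where [v] absorbs it as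
     [z^-1 ^+ n]. *)
  - move=> n s; rewrite VE hcomm !mulmxA vPhiVn -!scalemxAl mxE.
    by rewrite mulrCA.
  - exact: (hb (- mu) c c0).2.
apply: (negP v0); apply/eqP.
by rewrite -[v]mulmx1 -(subrK P 1%:M) mulmxDr vP vQ addr0.
Qed.
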